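(* Let $\mathcal F$ be a $k$-graph on $n$ vertices with $|\mathcal F|=n^r$ edges, where $r\ge1$, and let $\alpha\in(0,1]$. Suppose that $$\wp(\mathcal F,\alpha n)\le\min\Big\{\binom{x}{k-\lceil r\rceil}n,\ \tfrac12|\mathcal F|\Big\}$$ for some real $x\ge 2k$. Then for every integer $i$ with $r+1\le i\le k$, $$\Big|\binom{\mathcal F}{i}\Big|\ge\frac1C\cdot\frac{\binom{x}{i}}{\binom{x}{k}}|\mathcal F|,\qquad C=(8k/\alpha)^{\lceil 5r\rceil}\log_2 n .$$
   Context: A $k$-graph is a $k$-uniform hypergraph. For real $y$ and integer $i\ge0$, $\binom{y}{i}=y(y-1)\cdots(y-i+1)/i!$. For a hypergraph $\mathcal F$ and integer $i$, $\binom{\mathcal F}{i}=\{S:|S|=i,\ \exists e\in\mathcal F,\ S\subseteq e\}$. For a vertex set $I$, $\mathcal F[I]=\{e\in\mathcal F: e\subseteq I\}$ is the induced sub-hypergraph, and $\wp(\mathcal F,i)=\max_{|I|=i}|\mathcal F[I]|$ is the maximum number of edges induced on $i$ vertices. $\alpha n$ is rounded to an integer; $n$ is assumed sufficiently large. *)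

(* Defs.v *)
From mathcomp Require Import all_boot.
From Stdlib Require Import Reals ZArith.
Set Implicit Arguments. Unset Strict Implicit. Unset Printing Implicit Defensive.

Definition is_kgraph (n k : nat) (F : {set {set 'I_n}}) : Prop :=
  forall e, e \in F -> #|e| = k.

Definition induced n (F : {set {set 'I_n}}) (I : {set 'I_n}) : {set {set 'I_n}} :=
  [set e in F | e \subset I].

Definition wp n (F : {set {set 'I_n}}) (i : nat) : nat :=
  \max_(I : {set 'I_n} | #|I| == i) #|induced F I|.

Definition shadow n (F : {set {set 'I_n}}) (i : nat) : {set {set 'I_n}} :=
  [set S : {set 'I_n} | (#|S| == i) && [exists e in F, S \subset e]].

Local Open Scope R_scope.

Fixpoint Rfalling (y : R) (i : nat) : R :=
  match i with
  | O => 1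
  | S j => Rfalling y j * (y - INR j)
  end.

Definition Rbinom (y : R) (i : nat) : R := Rfalling y i / INR (fact i).

Definition Rceil (x : R) : Z := (1 - up (- x))%Z.
Definition Rround (x : R) : Z := Int_part (x + / 2).

Definition log2 (x : R) : R := ln x / ln 2.

(* Main.v *)
Require Import Defs.
From Stdlib Require Import Reals ZArith Lra.
From mathcomp Require Import all_boot zify.
Set Implicit Arguments. Unset Strict Implicit. Unset Printing Implicit Defensive.

(* Write t = ceil(r), let X be about x and let Y = QX for a large constant Q
   depending on k and alpha.  Deleting the i-sets of degree less than Y^(k-i)
   one after the other leaves a subgraph H in which every covered i-set has
   degree at least Y^(k-i), and costs at most Y^(k-i) edges per deleted i-set;
   so it is enough to show |H| <= |F|/2.

   The (k-i)-uniform link of a covered i-set spans at least Y vertices, and this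
   propagates downwards: every covered set of size p <= i has degree of order
   Y^(k-p), so covered sets of size at most t have degree at least K X^(k-t)
   with K large.  Since |H| <= n^t, it follows that some set of at most
   alpha n vertices either spans more than X^(k-t) n edges, which the
   hypothesis forbids, or contains all of H, whence |H| <= |F|/2.  This
   dichotomy is proved by induction on t.  Put the few vertices of
   exceptionally high degree aside; for any other vertex v the induction
   hypothesis applies to the edges through v, so that they all lie in a small
   set A(v), and v has degree at least K X^(k-t) |A(v)| / k.  Hence a union of
   sets A(v) of size about alpha n would be too dense, and so the union of all
   the A(v) is small.

   All losses are constants depending on k and alpha, and the factor log_2 n
   of C absorbs them. *)

(* Equal cardinals may carry differently elaborated canonical structures, which
   [lia] would treat as distinct atoms. *)
Ltac lia_card :=
  repeat match goal with
  | H : is_true (_ <= _) |- _ => move: H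
  | H : @eq nat _ _ |- _ => move: H
  end;
  repeat match goal with |- context [@card.body ?T ?A] =>
    move: (@card.body T A) => ?
  end; lia.

(** * Stars and degree sums *)

(** Edges are kept whole instead of being cut down to the link of [P], so a star is again a
    [k]-graph inside [H]. *)
Definition star n (H : {set {set 'I_n}}) (P : {set 'I_n}) : {set {set 'I_n}} :=
  [set e in H | P \subset e].

Lemma star_setU1 n (H : {set {set 'I_n}}) P v :
  star H (v |: P) = [set e in star H P | v \in e].
Proof. by apply/setP=> e; rewrite !inE subUset sub1set -andbA [(v \in e) && _]andbC. Qed.

Lemma sum_degree_le n k (G : {set {set 'I_n}}) (U : {set 'I_n}) :
  (forall e, e \in G -> #|e| <= k) ->
  \sum_(v in U) #|[set e in G | v \in e]| <= k * #|G|.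
Proof.
move=> Gk.
under eq_bigr do rewrite -sum1dep_card.
rewrite (exchange_big_dep (mem G)) /=; last by move=> v e _ /andP[].
rewrite mulnC -sum_nat_const; apply: leq_sum => e eG.
rewrite sum1dep_card; apply: leq_trans (Gk _ eG).
by apply/subset_leq_card/subsetP=> v; rewrite inE => /andP[_ /andP[]].
Qed.

Lemma sum_star_le n k (H : {set {set 'I_n}}) (U P : {set 'I_n}) :
  is_kgraph k H -> \sum_(v in U) #|star H (v |: P)| <= k * #|star H P|.
Proof.
move=> Hk; under eq_bigr do rewrite star_setU1.
by apply: sum_degree_le => e; rewrite inE => /andP[/Hk->].
Qed.

Lemma cover_star_degree n k (H : {set {set 'I_n}}) (P : {set 'I_n}) D :
    is_kgraph k H ->
    (forall v, v \in cover (star H P) -> D <= #|star H (v |: P)|) ->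
  #|cover (star H P)| * D <= k * #|star H P|.
Proof.
move=> Hk HD; apply: leq_trans (sum_star_le (cover (star H P)) P Hk).
by rewrite -sum_nat_const; apply: leq_sum.
Qed.

Lemma star_sub n (H : {set {set 'I_n}}) P : star H P \subset H.
Proof. by apply/subsetP=> e; rewrite inE => /andP[]. Qed.

Lemma mem_cover n (G : {set {set 'I_n}}) v :
  reflect (exists2 e, e \in G & v \in e) (v \in cover G).
Proof. exact: (iffP bigcupP); move=> [e eG ve]; exists e. Qed.

(** * The core of large minimum degree *)

(** Take [H] with fewest edges among those satisfying the potential inequality [ok]. Deleting the
    star of a covered [i]-set of degree below [y] loses fewer than [y] edges and at least one shadow
    set, so [ok] would survive, against minimality. *)
Lemma exists_core n (F : {set {set 'I_n}}) i y :
  exists2 H : {set {set 'I_n}}, H \subset F &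
    (forall P, P \in shadow H i -> y <= #|star H P|) /\
    #|F| <= #|H| + y * #|shadow F i|.
Proof.
pose ok (H : {set {set 'I_n}}) :=
  (H \subset F) && (#|F| + y * #|shadow H i| <= #|H| + y * #|shadow F i|).
have okF : ok F by rewrite /ok subxx /=.
have [H /andP[HF HFy] Hmin] : exists2 H : {set {set 'I_n}},
    ok H & forall J : {set {set 'I_n}}, ok J -> #|H| <= #|J|.
  by case: (@arg_minnP _ F ok (fun H => #|H|) okF) => H; exists H.
exists H => //; split; last by apply: leq_trans HFy; exact: leq_addr.
move=> P PH; rewrite leqNgt; apply/negP=> lt_y.
have PHe := PH; move: PHe; rewrite inE => /andP[cP /existsP[e /andP[eH Pe]]].
pose H' := H :\: star H P.
have cH' : #|H'| + #|star H P| = #|H|.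
  by rewrite cardsD (setIidPr (star_sub _ _)) subnK // subset_leq_card ?star_sub.
have star0 : 0 < #|star H P| by apply/card_gt0P; exists e; rewrite inE eH.
have sH' : shadow H' i \subset shadow H i :\ P.
  apply/subsetP=> R; rewrite !inE => /andP[-> /existsP[f /andP[]]].
  rewrite !inE => /andP[nf fH] Rf; rewrite fH in nf.
  have -> : R != P by apply: contraNneq nf => <-; rewrite Rf.
  by apply/existsP; exists f; rewrite fH.
have cs : #|shadow H' i| + 1 <= #|shadow H i|.
  by rewrite [X in _ <= X](cardsD1 P) PH addnC leq_add2l subset_leq_card.
have okH' : ok H'.
  rewrite /ok (subset_trans (subsetDl _ _) HF) /=.
  have : y * (#|shadow H' i| + 1) <= y * #|shadow H i| by rewrite leq_mul2l cs orbT.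
  by rewrite mulnDr muln1; lia_card.
by have := Hmin _ okH'; lia.
Qed.

(** * Degrees of smaller covered sets *)

Lemma subset_card_between n (P e : {set 'I_n}) i :
  P \subset e -> #|P| <= i <= #|e| ->
  exists2 R : {set 'I_n}, P \subset R /\ R \subset e & #|R| = i.
Proof.
move=> Pe /andP[]; elim: i => [|i IH].
  by rewrite leqn0 cards_eq0 => /eqP P0 _; exists P => //; rewrite P0 cards0.
rewrite leq_eqVlt => /predU1P[<- _|Pi ie]; first by exists P.
case: (IH Pi (ltnW ie)) => R [PR Re] cR.
have /properP[_ [v ve vR]] : R \proper e by rewrite properEcard Re cR.
exists (v |: R); last by rewrite cardsU1 vR cR.
by rewrite subUset sub1set ve Re (subset_trans PR) ?subsetUr.
Qed.

(** Removing [P] maps the star injectively to subsets of fixed size of the remaining covered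
    vertices. *)
Lemma card_star_le n k (H : {set {set 'I_n}}) (P : {set 'I_n}) :
  is_kgraph k H -> #|star H P| <= #|cover (star H P) :\: P| ^ (k - #|P|).
Proof.
move=> Hk; set A := _ :\: P.
have inj : {in star H P &, injective (fun e => e :\: P)}.
  move=> e f; rewrite !inE => /andP[_ Pe] /andP[_ Pf] ef.
  by rewrite -(setID e P) -(setID f P) ef (setIidPr Pe) (setIidPr Pf).
rewrite -(card_in_imset inj).
apply: (@leq_trans 'C(#|A|, k - #|P|)); last first.
  case: (k - #|P|) => [|m]; first by rewrite bin0 expn0.
  apply: (@leq_trans (#|A| ^_ m.+1)); first by rewrite -bin_ffact leq_pmulr ?fact_gt0.
  elim: m.+1 => // p IH; rewrite ffactnSr expnSr leq_mul // leq_subr //.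
rewrite -cards_draws; apply/subset_leq_card/subsetP=> g /imsetP[e eH ->].
rewrite inE; move: (eH); rewrite inE => /andP[/Hk ek Pe].
rewrite cardsD (setIidPr Pe) ek eqxx andbT.
by apply: setSD; apply/subsetP => v ve; apply/mem_cover; exists e.
Qed.

(** Downward induction on the size of [P]. Extend [P] to a covered [i]-set [R]; by [card_star_le]
    its link spans at least [Y] vertices [v], and each [v |: P] is covered and larger. Summing their
    degrees counts an edge at most [k] times, hence one factor [k] per level. *)
Lemma degree_below n k i Y (H : {set {set 'I_n}}) :
    is_kgraph k H -> i < k ->
    (forall P, P \in shadow H i -> Y ^ (k - i) <= #|star H P|) ->
  forall (P e : {set 'I_n}), e \in H -> P \subset e -> #|P| <= i ->
  Y ^ (k - #|P|) <= k ^ (i - #|P|) * #|star H P|.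
Proof.
move=> Hk ik HY P e eH Pe Pi; move: {2}(i - #|P|) (erefl (i - #|P|)) => d.
elim: d P e eH Pe Pi => [|d IH] P e eH Pe Pi dE.
  rewrite dE mul1n; have Pi' : #|P| = i by lia.
  rewrite Pi'; apply: HY; rewrite inE Pi' eqxx /=; apply/existsP; exists e.
  by rewrite eH.
have [R [PR Re] Ri] : exists2 R : {set 'I_n}, P \subset R /\ R \subset e & #|R| = i.
  by apply: subset_card_between; rewrite // (Hk _ eH) Pi ltnW.
have RH : R \in shadow H i.
  by rewrite inE Ri eqxx; apply/existsP; exists e; rewrite eH.
set A := cover (star H R) :\: R.
have AY : Y <= #|A|.
  have := leq_trans (HY _ RH) (card_star_le R Hk).
  by rewrite Ri leq_exp2r // subn_gt0.
rewrite dE expnS -mulnA mulnCA.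
apply: (@leq_trans (k ^ d * \sum_(v in A) #|star H (v |: P)|)); last first.
  by rewrite leq_mul2l sum_star_le ?orbT.
have -> : k - #|P| = (k - #|P|.+1).+1 by lia.
rewrite expnS big_distrr /=.
apply: (@leq_trans (#|A| * Y ^ (k - #|P|.+1))); first by rewrite leq_mul2r AY orbT.
rewrite -sum_nat_const; apply: leq_sum => v.
rewrite inE => /andP[vR /mem_cover[f]]; rewrite inE => /andP[fH Rf] vf.
have cvP : #|v |: P| = #|P|.+1 by rewrite cardsU1 (contraNN (subsetP PR v) vR).
have := IH (v |: P) f fH; rewrite cvP.
have -> : i - #|P|.+1 = d by lia.
by apply=> //; rewrite ?subUset ?sub1set ?vf ?(subset_trans PR) //; lia.
Qed.

(** * The dichotomy between a dense spot and confinement *)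

(** In a minimal subfamily whose union exceeds [b], dropping one member brings the union back to at
    most [b], so the overshoot is at most [c]. *)
Lemma bigcup_minimal_gt n (W : {set 'I_n}) (A : 'I_n -> {set 'I_n}) b c :
    (forall v, v \in W -> #|A v| <= c) -> b < #|\bigcup_(v in W) A v| ->
  exists2 U : {set 'I_n}, U \subset W & b < #|\bigcup_(v in U) A v| <= b + c.
Proof.
move=> Ac bW.
pose big (U : {set 'I_n}) := b < #|\bigcup_(v in U) A v|.
have [U /minsetP[bU Umin] UW] := @minset_exists _ big W bW.
exists U => //; apply/andP; split; first exact: bU.
have [U0|[u uU]] := set_0Vmem U.
  by move: bU; rewrite /big U0 big_set0 cards0.
have : ~~ big (U :\ u).
  apply/negP=> bUu; have := Umin _ bUu (subsetDl _ _).
  by move=> UE; move: uU; rewrite -UE setD11.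
rewrite /big -leqNgt => leb.
rewrite (big_setD1 u uU) /= addnC.
apply: leq_trans (leq_card_setU _ _) _.
by rewrite leq_add // Ac // (subsetP UW).
Qed.

Lemma sum_card_ge_bigcup n (U : {set 'I_n}) (A : 'I_n -> {set 'I_n}) :
  #|\bigcup_(v in U) A v| <= \sum_(v in U) #|A v|.
Proof.
elim/big_rec2: _ => [|v m B _ le]; first by rewrite cards0.
by apply: leq_trans (leq_card_setU _ _) _; rewrite leq_add2l.
Qed.

(** Edges through [v |: S] with [v] in [I] lie inside the union, and each is counted for at most [k]
    vertices [v]. *)
Lemma induced_bigcup_cover_ge n k (H : {set {set 'I_n}}) (S I : {set 'I_n}) D :
    is_kgraph k H ->
    (forall v, v \in I -> D * #|cover (star H (v |: S))| <= k * #|star H (v |: S)|) ->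
  D * #|\bigcup_(v in I) cover (star H (v |: S))| <=
    k * (k * #|induced H (\bigcup_(v in I) cover (star H (v |: S)))|).
Proof.
move=> Hk HD; set X := \bigcup_(v in I) _.
apply: (@leq_trans (D * \sum_(v in I) #|cover (star H (v |: S))|)).
  by rewrite leq_mul2l sum_card_ge_bigcup orbT.
rewrite big_distrr /=.
apply: (@leq_trans (\sum_(v in I) k * #|star H (v |: S)|)); first exact: leq_sum.
rewrite -big_distrr /= leq_mul2l; apply/orP; right.
apply: leq_trans (@sum_degree_le n k (induced H X) I _); last first.
  by move=> e; rewrite inE => /andP[/Hk->].
apply: leq_sum => v vI; apply/subset_leq_card/subsetP=> e eS.
move: (eS); rewrite !inE subUset sub1set => /andP[-> /andP[-> _]].
rewrite andbT; apply/subsetP=> w we; apply/bigcupP; exists v => //.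
by apply/mem_cover; exists e.
Qed.

(** [S] collects the vertices fixed so far: passing from [S] to [v |: S] lowers the exponent by one,
    and [L] absorbs the growth of the constant in the bound on the star. *)
Lemma dense_or_confined (k j : nat) : forall a L : nat, 0 < a -> 0 < L ->
  exists K N : nat, forall n, N <= n ->
  forall (H : {set {set 'I_n}}) (S : {set 'I_n}) (B D : nat),
    0 < B -> K * B <= D -> is_kgraph k H -> #|S| <= k ->
    (forall P e : {set 'I_n}, e \in H -> P \subset e -> #|P| <= #|S| + j.+1 ->
       D <= #|star H P|) ->
    #|star H S| <= L * n ^ j.+1 ->
  exists2 I : {set 'I_n}, a * #|I| <= n &
    B * n < #|induced H I| \/ star H S \subset induced H I.
Proof.
elim: j => [|j IH] a L a0 L0.
  exists (k.+1 * L * a), 0 => n _ H S B D B0 KD Hk _ HD HL.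
  exists (cover (star H S)); last first.
    right; apply/subsetP=> e eS; rewrite inE (subsetP (star_sub H S)) //=.
    by apply/subsetP=> v ve; apply/mem_cover; exists e.
  have : #|cover (star H S)| * D <= k * #|star H S|.
    apply: cover_star_degree => // v /mem_cover[e].
    rewrite inE => /andP[eH Se] ve; apply: (HD _ e) => //.
      by rewrite subUset sub1set ve Se.
    by rewrite cardsU1 addn1; case: (v \notin S) => //=; rewrite add0n.
  set A := #|cover _|; move: A #|star H S| HL => A M; rewrite expn1 => HL HA.
  have : A * (k.+1 * L * a * B) <= k.+1 * L * n.
    apply: (@leq_trans (A * D)); first by rewrite leq_mul2l KD orbT.
    apply: leq_trans HA _; rewrite -mulnA; apply: leq_mul => //.
  have -> : A * (k.+1 * L * a * B) = k.+1 * L * (a * A * B) by lia.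
  rewrite leq_pmul2l ?muln_gt0 ?L0 //; apply: leq_trans.
  by rewrite leq_pmulr.
have [k0|kpos] := posnP k.
  exists 0, 0 => n _ H S B D B0 _ Hk _ _ _; exists set0; first by rewrite cards0 muln0.
  right; apply/subsetP=> e; rewrite !inE => /andP[eH _]; rewrite eH /=.
  by have /eqP := Hk _ eH; rewrite k0 cards_eq0 => /eqP->; rewrite sub0set.
(* The factor [4 * a] makes each [A v] at most a quarter of the allowed size; [2 * a * k * L] is the
   degree threshold that leaves at most [n / (2a)] exceptional vertices in [T]. *)
have a4 : 0 < 4 * a by rewrite muln_gt0.
have aL : 0 < 2 * a * k * L by rewrite !muln_gt0 a0 kpos.
have [K [N IHK]] := IH _ _ a4 aL.
(* The term [4 * a * k * k] is the density lost in the final double count; [4 * a * k] in the bound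
   on [n] makes [S] negligible. *)
exists (K + 4 * a * k * k), (N + 4 * a * k + 1) => n nN H S B D B0 KD Hk Sk HD HL.
have KBD : K * B <= D by apply: leq_trans KD; rewrite leq_mul2r leq_addr orbT.
have n0 : 0 < n by lia.
pose T := [set v : 'I_n | 2 * a * k * L * n ^ j.+1 < #|star H (v |: S)|].
have cT : 2 * a * #|T| <= n.
  have : #|T| * (2 * a * k * L * n ^ j.+1) <= k * #|star H S|.
    apply: leq_trans (sum_star_le T S Hk); rewrite -sum_nat_const.
    by apply: leq_sum => v; rewrite inE => /ltnW.
  move=> /leq_trans/(_ (leq_mul (leqnn k) HL)).
  have -> : #|T| * (2 * a * k * L * n ^ j.+1) = k * L * n ^ j.+1 * (2 * a * #|T|) by lia.
  have -> : k * (L * n ^ j.+2) = k * L * n ^ j.+1 * n by rewrite (expnSr n); lia.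
  by rewrite leq_pmul2l // !muln_gt0 kpos L0 expn_gt0 n0.
pose W := ~: (T :|: S).
pose A v := cover (star H (v |: S)).
have cS : 4 * a * #|S| <= n.
  apply: (@leq_trans (4 * a * k)); first by rewrite leq_mul2l Sk orbT.
  by lia.
have step v : v \in W -> 4 * a * #|A v| <= n \/
    exists2 I : {set 'I_n}, a * #|I| <= n & B * n < #|induced H I|.
  rewrite !inE negb_or -leqNgt => /andP[vT vS].
  have [A0|[w]] := set_0Vmem (A v); first by left; rewrite A0 cards0 muln0.
  move=> /mem_cover[e]; rewrite inE => /andP[eH vSe] _.
  have [|||I aI] := IHK n _ H (v |: S) B D B0 KBD Hk _ _ vT; first by lia.
  - by rewrite -(Hk _ eH) subset_leq_card.
  - move=> P f fH Pf; rewrite cardsU1 vS add1n addSnnS => cP.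
    exact: (HD P f).
  case=> [dense|conf]; [right|left].
    exists I => //; apply: leq_trans aI; rewrite leq_mul2r; lia.
  apply: leq_trans aI; rewrite leq_mul2l subset_leq_card ?orbT //.
  apply/subsetP=> u /mem_cover[f /(subsetP conf)]; rewrite inE.
  by move=> /andP[_ /subsetP fI] /fI.
have [/existsP[I /andP[aI dense]]|nodense] :=
    boolP [exists I : {set 'I_n}, (a * #|I| <= n) && (B * n < #|induced H I|)].
  by exists I => //; left.
have smallA v : v \in W -> #|A v| <= n %/ (4 * a).
  move=> /step[]; first by rewrite leq_divRL // mulnC.
  by case=> I aI dense; case/existsP: nodense; exists I; rewrite aI.
(* If the union is small, then [T], [S] and the union take at most a half, a quarter and a quarter
   of [n / a], and together they confine the star. *)
have [leX|gtX] := leqP #|\bigcup_(v in W) A v| (n %/ (4 * a)).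
  exists (T :|: S :|: \bigcup_(v in W) A v).
    move: leX; rewrite leq_divRL // => leX.
    have c1 := leq_card_setU (T :|: S) (\bigcup_(v in W) A v).
    have : 4 * a * #|T :|: S :|: \bigcup_(v in W) A v| <=
      4 * a * (#|T| + #|S| + #|\bigcup_(v in W) A v|).
      rewrite leq_mul2l; apply/orP; right; apply: leq_trans c1 _.
      by rewrite leq_add2r leq_card_setU.
    by lia_card.
  right; apply/subsetP=> e eS; rewrite inE (subsetP (star_sub H S)) //=.
  move: (eS); rewrite inE => /andP[eH Se].
  apply/subsetP=> v ve; rewrite inE.
  have [//|vTS] := boolP (v \in T :|: S).
  apply/bigcupP; exists v; first by rewrite inE.
  apply/mem_cover; exists e => //.
  by rewrite inE eH subUset sub1set ve.
(* Otherwise stop the union between [n / (4a)] and [n / (2a)]: it fits the size bound, yet is large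
   enough to be dense. *)
have [U UW /andP[gtU leU]] := bigcup_minimal_gt smallA gtX.
exists (\bigcup_(v in U) A v); last left.
  have := leq_divM n (4 * a).
  move: leU; move: (n %/ _) #|_| => q u; nia.
have dA v : v \in U -> D * #|A v| <= k * #|star H (v |: S)|.
  move=> vU; rewrite mulnC; apply: cover_star_degree => // w /mem_cover[e].
  rewrite inE => /andP[eH vSe] we; apply: (HD _ e) => //.
    by rewrite subUset sub1set we vSe.
  rewrite !cardsU1; move: (w \notin _) (v \notin _) => [] []; lia_card.
have := induced_bigcup_cover_ge Hk dA.
move: gtU; rewrite ltn_divLR //.
set X := \bigcup_(v in U) _.
rewrite -/X; move: #|X| #|induced H X| => x m gtU dX.
have : D * n < 4 * a * k * k * m.
  have D0 : 0 < D by apply: leq_trans KD; rewrite muln_gt0 B0 addn_gt0 !muln_gt0 a0 kpos orbT.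
  have : D * n < D * (x * (4 * a)) by rewrite ltn_pmul2l.
  move=> /leq_trans; apply.
  have -> : 4 * a * k * k * m = k * (k * m) * (4 * a) by lia.
  by rewrite mulnA leq_mul2r dX orbT.
have : (4 * a * k * k * B) * n <= D * n.
  rewrite leq_mul2r; apply/orP; right; apply: leq_trans KD.
  by rewrite leq_mul2r leq_addl orbT.
move=> /leq_ltn_trans h /h; rewrite -mulnA ltn_pmul2l //.
by rewrite !muln_gt0 a0 kpos.
Qed.

(** The exponent comes from [r], which is chosen after [n], so the constants must serve all of the
    finitely many [j < m]; adding them up does this. *)
Lemma dense_or_confined_uniform (k a m : nat) : 0 < a ->
  exists K N : nat, forall j n, j < m -> N <= n ->
  forall (H : {set {set 'I_n}}) (B D : nat),
    0 < B -> K * B <= D -> is_kgraph k H ->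
    (forall P e : {set 'I_n}, e \in H -> P \subset e -> #|P| <= j.+1 ->
       D <= #|star H P|) ->
    #|H| <= n ^ j.+1 ->
  exists2 I : {set 'I_n}, a * #|I| <= n &
    B * n < #|induced H I| \/ H \subset induced H I.
Proof.
move=> a0; elim: m => [|m [K [N IH]]]; first by exists 0, 0.
have [K' [N' IH']] := @dense_or_confined k m a 1 a0 isT.
exists (K + K'), (N + N') => j n; rewrite ltnS leq_eqVlt => jm nN H B D B0.
rewrite mulnDl => KD Hk HD HL.
case/predU1P: jm => [jm|jm]; last by apply: (IH j n jm _ H B D) => //; lia.
have H0 : star H set0 = H by apply/setP=> e; rewrite inE sub0set andbT.
subst j; have := IH' n _ H set0 B D B0 _ Hk; rewrite H0 cards0 mul1n.
by apply=> //; lia.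
Qed.

(** * The shadow bound over the natural numbers *)

Lemma shadow_lower_bound (k a : nat) : 0 < a ->
  exists Q N : nat, 0 < Q /\ forall n, N <= n ->
  forall (F : {set {set 'I_n}}) (t i X : nat),
    is_kgraph k F -> 0 < t -> t < i -> i <= k -> 0 < X -> #|F| <= n ^ t ->
    (forall I : {set 'I_n}, a * #|I| <= n ->
       #|induced F I| <= X ^ (k - t) * n /\ 2 * #|induced F I| <= #|F|) ->
  #|F| <= 2 * (Q * X) ^ (k - i) * #|shadow F i|.
Proof.
move=> a0; have [K [N HK]] := @dense_or_confined_uniform k a k a0.
(* [k ^ k] pays for the loss in [degree_below], [K] for the degree demanded by the dichotomy; the
   successor keeps [Q] positive. *)
exists (k ^ k * K.+1), N; split.
  by case: (k) => [|k']; rewrite ?muln_gt0 ?expn_gt0.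
move=> n nN F t i X Fk t0 ti; rewrite leq_eqVlt => /predU1P[ik _ _ _|ik X0 Fn HF].
  rewrite ik subnn expn0 muln1 mul2n -addnn.
  apply: leq_trans (leq_addr _ _); apply/subset_leq_card/subsetP=> e eF.
  by rewrite inE (Fk _ eF) eqxx; apply/existsP; exists e; rewrite eF subxx.
set Q := k ^ k * K.+1.
have k0 : 0 < k by apply: leq_trans ik.
have [H HF' [HY FH]] := exists_core F i ((Q * X) ^ (k - i)).
have Hk : is_kgraph k H by move=> e /(subsetP HF')/Fk.
have Q0 : 0 < Q by rewrite muln_gt0 expn_gt0 k0.
have HD (P e : {set 'I_n}) : e \in H -> P \subset e -> #|P| <= t.-1.+1 ->
    K * X ^ (k - t) <= #|star H P|.
  rewrite prednK // => eH Pe Pt.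
  have := degree_below Hk ik HY eH Pe (leq_trans Pt (ltnW ti)).
  have : (Q * X) ^ (k - t) <= (Q * X) ^ (k - #|P|).
    by rewrite leq_pexp2l ?muln_gt0 ?Q0 //; lia.
  move=> /leq_trans h /h{h} le1.
  have le2 : k ^ (i - #|P|) * #|star H P| <= k ^ k * #|star H P|.
    rewrite leq_mul2r; apply/orP; right; rewrite leq_pexp2l //.
    exact: leq_trans (leq_subr _ _) (ltnW ik).
  (* Since [t < k], the power of [Q] is at least [Q] itself. *)
  have le3 : k ^ k * (K * X ^ (k - t)) <= (Q * X) ^ (k - t).
    rewrite expnMn mulnA leq_mul2r; apply/orP; right.
    apply: (@leq_trans (Q ^ 1)); first by rewrite expn1 leq_mul2l leqnSn orbT.
    by rewrite leq_pexp2l // subn_gt0 (ltn_trans ti).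
  have := leq_trans le3 (leq_trans le1 le2).
  by rewrite leq_pmul2l // expn_gt0 k0.
have Hn : #|H| <= n ^ t.-1.+1.
  by rewrite prednK //; apply: leq_trans Fn; apply: subset_leq_card.
have tk : t.-1 < k by rewrite prednK // (leq_trans (ltnW ti)) // ltnW.
have XB : 0 < X ^ (k - t) by rewrite expn_gt0 X0.
have [I aI HI] := HK _ _ tk nN H _ _ XB (leqnn _) Hk HD Hn.
have [F1 F2] := HF _ aI.
have HFI : induced H I \subset induced F I.
  by apply/subsetP=> e; rewrite !inE => /andP[/(subsetP HF')-> ->].
(* A dense [I] contradicts the first bound; confinement gives [2 * #|H| <= #|F|], so the edges lost
   in passing to the core are at least half of [F]. *)
case: HI => [dense|conf].
  by have := leq_trans dense (subset_leq_card HFI); rewrite ltnNge F1.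
have := subset_leq_card (subset_trans conf HFI).
rewrite -mulnA; move: F2 FH; move: (_ * #|shadow F i|) => u.
by lia_card.
Qed.

(** * Passage to real numbers *)

Lemma wp_ge n (F : {set {set 'I_n}}) (I : {set 'I_n}) m :
  #|I| <= m -> m <= n -> #|induced F I| <= wp F m.
Proof.
move=> Im mn.
have [|J [IJ _] cJ] := @subset_card_between n I setT m (subsetT _).
  by rewrite Im cardsT card_ord.
apply: (@leq_trans #|induced F J|).
  apply/subset_leq_card/subsetP=> e; rewrite !inE => /andP[-> eI].
  exact: subset_trans IJ.
by apply: (@leq_bigmax_cond _ _ (fun I => #|induced F I|)); rewrite cJ.
Qed.

Local Open Scope R_scope.

Lemma INR_leq m n : leq m n -> INR m <= INR n.
Proof. by move=> /leP/le_INR. Qed.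

Lemma leq_INR m n : INR m <= INR n -> leq m n.
Proof. by move=> /INR_le/leP. Qed.

Lemma INR_muln m n : INR (muln m n) = INR m * INR n.
Proof. exact: mult_INR. Qed.

Lemma INR_expn m n : INR (expn m n) = INR m ^ n.
Proof. by elim: n => [|n IH] //; rewrite expnS INR_muln IH. Qed.

Lemma Rceil_bounds x : x <= IZR (Rceil x) < x + 1.
Proof. by rewrite /Rceil minus_IZR; have := archimed (- x); lra. Qed.

Lemma Rround_bounds x : x - / 2 < IZR (Rround x) <= x + / 2.
Proof. by rewrite /Rround; have := base_Int_part (x + / 2); lra. Qed.

Lemma IZR_to_nat z : (0 <= z)%Z -> INR (Z.to_nat z) = IZR z.
Proof. by move=> z0; rewrite INR_IZR_INZ Z2Nat.id. Qed.

Lemma nat_between x : 0 <= x -> exists m : nat, x < INR m <= x + 1.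
Proof.
move=> x0; have := archimed x => ?; exists (Z.to_nat (up x)).
by rewrite IZR_to_nat; [lra | apply: le_IZR; lra].
Qed.

Lemma Rfalling_bounds x i : INR i < x -> 0 < Rfalling x i <= x ^ i.
Proof.
elim: i => [|i IH] ix; first by simpl; lra.
rewrite S_INR in ix; have [|p le] := IH; first by lra.
rewrite -tech_pow_Rmult Rmult_comm /=; have := pos_INR i => i0; split.
  by apply: Rmult_lt_0_compat; lra.
by apply: Rmult_le_compat; lra.
Qed.

(** Each of the [d] extra factors is at least [x / 2]. *)
Lemma Rfalling_add_ge x i d : 2 * INR (addn i d) <= x -> 0 < x ->
  Rfalling x i * (x / 2) ^ d <= Rfalling x (addn i d).
Proof.
move=> + x0; elim: d => [|d IH]; first by rewrite addn0 /=; lra.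
rewrite addnS S_INR => idx; have /IH{IH} : 2 * INR (addn i d) <= x by lra.
rewrite -tech_pow_Rmult [Rfalling x _.+1]/= => IH.
have [p _] := @Rfalling_bounds x (addn i d) ltac:(have := pos_INR (addn i d); lra).
have -> : Rfalling x i * (x / 2 * (x / 2) ^ d) = Rfalling x i * (x / 2) ^ d * (x / 2).
  by ring.
apply: Rle_trans (Rmult_le_compat_l _ (x / 2) _ _ _); [|lra|lra].
by apply: Rmult_le_compat_r; lra.
Qed.

Lemma Rbinom_le_pow x i : INR i < x -> Rbinom x i <= x ^ i.
Proof.
move=> /Rfalling_bounds[p le]; apply: Rle_trans le.
rewrite /Rbinom; have f1 : 1 <= INR (fact i) by have := le_INR _ _ (lt_O_fact i).
apply: (Rmult_le_reg_r (INR (fact i))); first lra.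
rewrite /Rdiv Rmult_assoc Rinv_l; last lra.
by nra.
Qed.

Lemma Rbinom_ratio_le x i d : 0 < x -> 2 * INR (addn i d) <= x ->
  0 <= Rbinom x i / Rbinom x (addn i d) <= INR (fact (addn i d)) * (2 / x) ^ d.
Proof.
move=> x0 idx.
have i_le : INR i <= INR (addn i d) by apply: INR_leq; exact: leq_addr.
have i_ge := pos_INR i.
have [p _] := @Rfalling_bounds x i ltac:(lra).
have [q _] := @Rfalling_bounds x (addn i d) ltac:(lra).
have H := Rfalling_add_ge idx x0.
have f1 : 1 <= INR (fact i) by have := le_INR _ _ (lt_O_fact i).
have f2 := INR_fact_lt_0 (addn i d).
rewrite /Rbinom; set f := INR (fact i) in f1 *; set g := INR _ in f2 *.
set P := Rfalling x i in p H *; set R := Rfalling x (addn i d) in q H *.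
have -> : P / f / (R / g) = g * (P / R * / f) by field; lra.
have PR0 : 0 < P / R by apply: Rdiv_lt_0_compat.
have if0 : 0 < / f <= 1.
  by split; [apply: Rinv_0_lt_compat; lra | rewrite -Rinv_1; apply: Rinv_le_contravar; lra].
split; first by apply: Rmult_le_pos; nra.
apply: Rmult_le_compat_l; first lra.
apply: (Rle_trans _ (P / R)); first by nra.
have -> : 2 / x = / (x / 2) by field; lra.
rewrite pow_inv; have y0 : 0 < (x / 2) ^ d by apply: pow_lt; lra.
apply: (Rmult_le_reg_r (R * (x / 2) ^ d)); first by nra.
have -> : P / R * (R * (x / 2) ^ d) = P * (x / 2) ^ d by field; lra.
have -> : / (x / 2) ^ d * (R * (x / 2) ^ d) = R by field; lra.
exact: H.
Qed.

Lemma log2_unbounded M : exists n0 : nat, forall n : nat, leq n0 n -> M <= log2 (INR n).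
Proof.
have [m [Mm _]] := nat_between (Rlt_le _ _ (exp_pos (M * ln 2))).
exists m => n /INR_leq mn; have l2 := ln_lt_2.
have E0 := exp_pos (M * ln 2).
rewrite /log2; apply: (Rmult_le_reg_r (ln 2)); first lra.
rewrite /Rdiv Rmult_assoc Rinv_l ?Rmult_1_r; last lra.
rewrite -{1}[M * ln 2]ln_exp; apply: Rlt_le; apply: ln_increasing; lra.
Qed.

(** * Assembly of the bound *)

Theorem theorem1p6 :
  forall (k : nat) (alpha : R), (0 < alpha <= 1)%R ->
  exists n0 : nat, forall n : nat, leq n0 n ->
  forall (F : {set {set 'I_n}}) (r x : R),
    is_kgraph k F ->
    INR #|F| = Rpower (INR n) r ->
    (1 <= r)%R ->
    (2 * INR k <= x)%R ->
    (INR (wp F (Z.to_nat (Rround (alpha * INR n))))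
       <= Rmin (Rbinom x (Z.to_nat (Z.of_nat k - Rceil r)%Z) * INR n)
               (/ 2 * INR #|F|))%R ->
    forall i : nat, (r + 1 <= INR i)%R -> leq i k ->
      let C := ((8 * INR k / alpha) ^ Z.to_nat (Rceil (5 * r)) * log2 (INR n))%R in
      (/ C * (Rbinom x i / Rbinom x k) * INR #|F| <= INR #|shadow F i|)%R.
Proof.
move=> k alpha [alpha0 alpha1].
have ia : 1 <= / alpha by rewrite -Rinv_1; apply: Rinv_le_contravar; lra.
have [a [a_gt _]] := @nat_between (/ alpha) ltac:(lra).
have a0 : ltn 0%N a by apply/ltP/INR_lt => /=; lra.
have [Q [N [Q0 HN]]] := shadow_lower_bound k a0.
(* [INR (fact k)] comes from the ratio of binomials, [2] and [INR Q] from the shadow bound, and [4]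
   from [2 / x] times [2 * x]. *)
pose M := 2 * INR (fact k) * (4 * INR Q) ^ k.
have [n1 Hn1] := log2_unbounded M.
exists (addn (addn N n1) 1%N) => n nN F r x Fk Fr r1 kx Hwp i ri ik C.
have n1R : 1 <= INR n by apply: (@INR_leq 1%N n); lia.
have [rc1 rc2] := Rceil_bounds r.
have rc0 : (0 < Rceil r)%Z by apply: lt_IZR; lra.
set t := Z.to_nat (Rceil r).
have tE : INR t = IZR (Rceil r) by apply: IZR_to_nat; lia.
have t0 : ltn 0%N t by apply/ltP/INR_lt; rewrite tE /=; lra.
have ti : ltn t i by apply/ltP/INR_lt; lra.
have k2 : 2 <= INR k by have := INR_leq ik; lra.
have ktE : Z.to_nat (Z.of_nat k - Rceil r)%Z = subn k t by lia.
rewrite ktE in Hwp.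
have [X [xX Xx]] := @nat_between x ltac:(lra).
have X0 : ltn 0%N X by apply/ltP/INR_lt => /=; lra.
have Fn : leq #|F| (expn n t).
  apply: leq_INR; rewrite Fr INR_expn -Rpower_pow; last lra.
  by apply: Rle_Rpower; lra.
set m := Z.to_nat (Rround (alpha * INR n)) in Hwp.
have [rd1 rd2] := Rround_bounds (alpha * INR n).
have an : 0 < alpha * INR n <= INR n by nra.
have rd0 : (0 <= Rround (alpha * INR n))%Z.
  by apply: Zlt_succ_le; apply: lt_IZR; rewrite succ_IZR; lra.
have mE : INR m = IZR (Rround (alpha * INR n)) by apply: IZR_to_nat.
have mn : leq m n.
  by rewrite -ltnS; apply/ltP/INR_lt; rewrite S_INR; lra.
have sparse (I : {set 'I_n}) : leq (muln a #|I|) n ->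
    leq #|induced F I| (muln (expn X (subn k t)) n) /\
    leq (muln 2%N #|induced F I|) #|F|.
  move=> /INR_leq; rewrite INR_muln => aI.
  (* Rounding costs at most one half, which is harmless because [#|I|] is an integer. *)
  have Im : leq #|I| m.
    rewrite -ltnS; apply/ltP/INR_lt; rewrite S_INR.
    have : INR #|I| <= alpha * INR n.
      have I0 := pos_INR #|I|.
      have : alpha * (INR a * INR #|I|) <= alpha * INR n by apply: Rmult_le_compat_l; lra.
      have : 1 <= alpha * INR a.
        by have := Rmult_lt_compat_l _ _ _ alpha0 a_gt; rewrite Rinv_r; lra.
      by nra.
    by lra.
  have /INR_leq le := wp_ge F Im mn.
  have B1 := Rmin_l (Rbinom x (subn k t) * INR n) (/ 2 * INR #|F|).
  have B2 := Rmin_r (Rbinom x (subn k t) * INR n) (/ 2 * INR #|F|).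
  split; apply: leq_INR; rewrite INR_muln ?INR_expn; last first.
    by change (INR 2%N) with 2; lra.
  have : Rbinom x (subn k t) <= INR X ^ subn k t.
    apply: (Rle_trans _ (x ^ subn k t)).
      by apply: Rbinom_le_pow; have := INR_leq (leq_subr t k); lra.
    by apply: pow_incr; lra.
  by nra.
have /INR_leq := HN n ltac:(lia) F t i X Fk t0 ti ik X0 Fn sparse.
rewrite !INR_muln INR_expn INR_muln; change (INR 2%N) with 2 => HF.
set d := subn k i in HF; have kE : k = addn i d by rewrite subnKC.
have [b0 b1] := @Rbinom_ratio_le x i d ltac:(lra) ltac:(by rewrite -kE).
rewrite -kE in b0 b1.
set S := INR #|shadow F i| in HF *; have S0 : 0 <= S by apply: pos_INR.
have Q1 : 1 <= INR Q by apply: (@INR_leq 1%N Q).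
have f0 := INR_fact_lt_0 k.
have x0 : 0 < x by lra.
have M0 : 0 < M by apply: Rmult_lt_0_compat; [lra | apply: pow_lt; lra].
(* The power of [8k/alpha] is only bounded below by 1; the logarithm alone exceeds [M]. *)
have CM : M <= C.
  have : 1 <= (8 * INR k / alpha) ^ Z.to_nat (Rceil (5 * r)).
    by apply: pow_R1_Rle; rewrite /Rdiv; nra.
  have : M <= log2 (INR n) by apply: Hn1; lia.
  by rewrite /C; nra.
(* Here [X <= x + 1 <= 2 * x], and the powers of [x] cancel. *)
have HM : Rbinom x i / Rbinom x k * INR #|F| <= M * S.
  apply: (Rle_trans _ (INR (fact k) * (2 / x) ^ d * (2 * (INR Q * (2 * x)) ^ d * S))).
    apply: Rmult_le_compat => //; first exact: pos_INR.
    apply: Rle_trans HF _; apply: Rmult_le_compat_r => //.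
    apply: Rmult_le_compat_l; first lra.
    apply: pow_incr; split; first by apply: Rmult_le_pos; lra.
    by apply: Rmult_le_compat_l; lra.
  have -> : INR (fact k) * (2 / x) ^ d * (2 * (INR Q * (2 * x)) ^ d * S) =
      2 * INR (fact k) * ((2 / x) ^ d * (INR Q * (2 * x)) ^ d) * S by ring.
  rewrite -Rpow_mult_distr.
  have -> : 2 / x * (INR Q * (2 * x)) = 4 * INR Q by field; lra.
  apply: Rmult_le_compat_r => //; apply: Rmult_le_compat_l; first lra.
  by apply: Rle_pow; [lra | apply/leP; rewrite kE leq_addl].
rewrite Rmult_assoc; apply: (Rmult_le_reg_l C); first lra.
rewrite -Rmult_assoc Rinv_r; last lra.
by nra.
Qed.
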